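(* Let $K$ be a field with $\mathrm{ch}(K)\neq 2$, let $X=(x_{ij})$ be an $n\times n$ generic skew-symmetric matrix, let $Y=(y_1,\dots,y_n)^{T}$ be the generic $n\times 1$ column matrix, let $R$ be the polynomial algebra over $K$ in the indeterminates occurring in $X$ and $Y$, and let $g_1,\dots,g_n\in R$ be the entries of $XY$. For $1\le t\le n$ put $\mathcal{J}_t=\langle g_1,\dots,g_t\rangle\subseteq R$. Then: (i) $g_1,\dots,g_{n-1}$ is a regular sequence in $R$. (ii) For every $1\le t\le n-2$, the ideal $\mathcal{J}_t=\langle g_1,\dots,g_t\rangle$ is a prime ideal in $R$.
   Context: ''Generic skew-symmetric'' means that the $x_{ij}$ with $1\le i<j\le n$ are distinct indeterminates over $K$, $x_{ji}=-x_{ij}$ and $x_{ii}=0$. The $y_j$ are further distinct indeterminates. Thus $g_i=\sum_{j=1}^n x_{ij}y_j$. *)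

(* Defs.v *)
From mathcomp Require Import all_boot all_order all_algebra.
From mathcomp Require Import boolp.
From mathcomp Require Import mpoly.

Set Implicit Arguments.
Unset Strict Implicit.
Unset Printing Implicit Defensive.

Import GRing.Theory.
Local Open Scope ring_scope.

Section Ideals.
Variable R : comNzRingType.

(* The boolean reflection is classical: ring_quotient.v expects ideals to be
   boolean predicates. *)
Definition ideal_gen (s : seq R) : {pred R} :=
  [pred f | `[< exists c : 'I_(size s) -> R,
                  f = \sum_(i < size s) c i * s`_i >]].

(* [idealr_closed] includes properness (1 is not in I). *)
Definition prime_ideal (I : {pred R}) : Prop :=
  idealr_closed I /\ prime_idealr_closed I.

(* The quotient by the ideal generated by s is nonzero, and s`_i is a
   nonzerodivisor modulo the ideal generated by s`_0, ..., s`_(i-1). *)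
Definition regular_seq (s : seq R) : Prop :=
  1 \notin ideal_gen s /\
  forall i, (i < size s)%N ->
    forall f, s`_i * f \in ideal_gen (take i s) -> f \in ideal_gen (take i s).

End Ideals.

Section Generic.
Variables (K : fieldType) (n : nat).

(* The left summand indexes the x_ij with i < j, the right one the y_j. *)
Definition gen_var : finType :=
  ({p : 'I_n * 'I_n | (p.1 < p.2)%N} + 'I_n)%type.

Definition gen_ring : comNzRingType := {mpoly K[#|gen_var|]}.

Definition indet (v : gen_var) : gen_ring := 'X_(enum_rank v).

Definition xvar (i j : 'I_n) : gen_ring :=
  if insub (i, j) is Some p then indet (inl p) else 0.

(* At most one of the two terms is nonzero, since xvar i j = 0 unless i < j. *)
Definition gen_skew : 'M[gen_ring]_n := \matrix_(i, j) (xvar i j - xvar j i).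

Definition gen_col : 'cV[gen_ring]_n := \col_j indet (inr j).

(* The first t of the entries g_1, ..., g_n of XY, for t <= n. *)
Definition gseq (t : nat) : seq gen_ring :=
  take t [seq (gen_skew *m gen_col) i 0 | i <- enum 'I_n].

End Generic.

(* Main.v *)
Require Import Defs.
From mathcomp Require Import all_boot all_order all_algebra.
From mathcomp Require Import boolp.
From mathcomp Require Import mpoly.
From mathcomp Require Import ring.

(** In a fixed ring [R], let [g^(m)_i] be the sum of [x_ij y_j] over the first
    [m] values of [j], and [J^(m)_t] the ideal of the first [t] of these. By
    induction on [m], the terms [g^(m)_1, ..., g^(m)_(m-1)] are successively
    nonzerodivisors modulo their predecessors ([trunc_regularP]); for [m = n]
    this gives the regular sequence, and the induction step gives the primes.

    For the step from [l] to [l+1], let [t < l] and let [y] be the variable of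
    the last column, so that [g^(l+1)_i = g^(l)_i + x_i y], where [x_i] is the
    last entry of row [i]. If [y] is inverted, each equation [g^(l+1)_i = 0]
    with [i <= t] can be solved for [x_i], as [g^(l)_i] and the other solutions
    do not involve [x_i]. Hence the localised quotient is a localised polynomial
    ring, and [J^(l+1)_t] is the kernel of the morphism
    [x_i |-> - g^(l)_i / y] to the fractions of [R], thus prime, as soon as [y]
    is a nonzerodivisor modulo [J^(l+1)_t] ([trunc_ideal_prime]).

    That last point ([last_col_nonzerodivisor]) is where the smaller size comes
    in. Setting [y] to [0] turns [g^(l+1)_i] into [g^(l)_i], so the induction
    hypothesis says that [y, g^(l+1)_1, ..., g^(l+1)_t] is a regular sequence,
    and then [y] can be moved to its end ([nonzerodivisor_moved_last]). The
    bound [t < l] matters: [y_1 g_1 + ... + y_n g_n = 0] puts [y_n g_n] into the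
    ideal of [g_1, ..., g_(n-1)], so [y_n] is a zerodivisor there for [n > 1].

    Finally, modulo the prime [J^(l+1)_t] the next term [g^(l+1)_(t+1)] is a
    nonzerodivisor because it is not in that ideal ([trunc_entry_notin]). *)

Set Implicit Arguments.
Unset Strict Implicit.
Unset Printing Implicit Defensive.

Import GRing.Theory.
Local Open Scope ring_scope.

(** * Ideals generated by a finite sequence *)

Section IdealGen.
Variable R : comNzRingType.
Implicit Types (a b c f g : R) (s : seq R).

Lemma ideal_gen_nilP f : reflect (f = 0) (f \in ideal_gen [::]).
Proof.
apply: (iffP (asboolP _)) => [[c ->]|->]; first by rewrite big_ord0.
by exists (fun=> 0); rewrite big_ord0.
Qed.

Lemma ideal_gen_consP b s f :
  reflect (exists c, f - c * b \in ideal_gen s) (f \in ideal_gen (b :: s)).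
Proof.
apply: (iffP (asboolP _)) => [[c ->]|[c /asboolP[d fE]]].
  exists (c ord0); apply/asboolP; exists (fun i => c (lift ord0 i)).
  by rewrite big_ord_recl /= addrC addKr.
exists (fun i => oapp d c (unlift ord0 i)).
rewrite big_ord_recl /= unlift_none /=.
under eq_bigr do rewrite liftK /=.
by rewrite -fE addrC subrK.
Qed.

Lemma ideal_gen0 s : 0 \in ideal_gen s.
Proof.
apply/asboolP; exists (fun=> 0).
by rewrite big1 // => i _; rewrite mul0r.
Qed.

Lemma ideal_genD s f g :
  f \in ideal_gen s -> g \in ideal_gen s -> f + g \in ideal_gen s.
Proof.
move=> /asboolP[c ->] /asboolP[d ->]; apply/asboolP; exists (fun i => c i + d i).
by rewrite -big_split; apply: eq_bigr => i _; rewrite mulrDl.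
Qed.

Lemma ideal_genMl s a f : f \in ideal_gen s -> a * f \in ideal_gen s.
Proof.
move=> /asboolP[c ->]; apply/asboolP; exists (fun i => a * c i).
by rewrite big_distrr; apply: eq_bigr => i _; rewrite /= mulrA.
Qed.

Lemma ideal_gen_mem s f : f \in s -> f \in ideal_gen s.
Proof.
elim: s => // b s IHs; rewrite inE => /predU1P[->|/IHs fs]; apply/ideal_gen_consP.
  by exists 1; rewrite mul1r subrr ideal_gen0.
by exists 0; rewrite mul0r subr0.
Qed.

Lemma ideal_gen_closed (I : {pred R}) s f :
    0 \in I -> (forall a g h, g \in I -> h \in I -> a * g + h \in I) ->
    {subset s <= I} ->
  f \in ideal_gen s -> f \in I.
Proof.
move=> I0 IDM; elim: s f => [|b s IHs] f sI; first by move/ideal_gen_nilP->.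
move=> /ideal_gen_consP[c fs]; rewrite -[f](subrK (c * b)) addrC.
apply: IDM; first by rewrite sI ?mem_head.
by apply: IHs fs => g gs; rewrite sI // inE gs orbT.
Qed.

Lemma ideal_gen_subset s s' f :
  {subset s <= ideal_gen s'} -> f \in ideal_gen s -> f \in ideal_gen s'.
Proof.
apply: ideal_gen_closed; first exact: ideal_gen0.
by move=> a g h gs hs; rewrite ideal_genD // ideal_genMl.
Qed.

Lemma ideal_gen_rconsP b s f :
  reflect (exists c, f - c * b \in ideal_gen s) (f \in ideal_gen (rcons s b)).
Proof.
suff -> : (f \in ideal_gen (rcons s b)) = (f \in ideal_gen (b :: s)).
  exact: ideal_gen_consP.
by apply/idP/idP; apply: ideal_gen_subset => g gs; apply: ideal_gen_mem;
  move: gs; rewrite mem_rcons.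
Qed.

(** Reordering a regular sequence can destroy regularity; what survives is that
    the first term may be moved last, as far as the moved term is concerned.
    From [a * f = e + c * b] with [e] in the ideal of the earlier terms,
    regularity of [b] modulo [a] makes [c] a multiple of [a] up to the earlier
    terms, so the term in [b] can be divided by [a] as well. *)
Lemma nonzerodivisor_moved_last a s :
    (forall f, a * f = 0 -> f = 0) ->
    (forall i, (i < size s)%N -> forall f,
       s`_i * f \in ideal_gen (a :: take i s) -> f \in ideal_gen (a :: take i s)) ->
  forall f, a * f \in ideal_gen s -> f \in ideal_gen s.
Proof.
move=> areg; elim/last_ind: s => [|s b IHs] sreg f.
  by move=> /ideal_gen_nilP/areg->; exact: ideal_gen0.
have {}IHs : forall f, a * f \in ideal_gen s -> f \in ideal_gen s.
  apply: IHs => i lt_is; have := sreg i.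
  rewrite size_rcons nth_rcons lt_is -cats1 takel_cat; last exact: ltnW.
  by apply; apply: leqW.
move=> /ideal_gen_rconsP[c afs].
have /ideal_gen_consP[d cs] : c \in ideal_gen (a :: s).
  have := sreg (size s).
  rewrite size_rcons nth_rcons ltnn eqxx -cats1 take_size_cat //.
  apply; first by [].
  apply/ideal_gen_consP; exists f; rewrite -(opprB (f * a)) -mulN1r ideal_genMl //.
  by rewrite mulrC (mulrC b).
apply/ideal_gen_rconsP; exists d; apply: IHs.
have -> : a * (f - d * b) = a * f - c * b + b * (c - d * a) by ring.
by rewrite ideal_genD // ideal_genMl.
Qed.

End IdealGen.

Lemma ideal_gen_map (R S : comNzRingType) (phi : {rmorphism R -> S}) s f :
  f \in ideal_gen s -> phi f \in ideal_gen (map phi s).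
Proof.
elim: s f => [|b s IHs] f /=.
  by move=> /ideal_gen_nilP->; rewrite rmorph0 ideal_gen0.
move=> /ideal_gen_consP[c fs]; apply/ideal_gen_consP; exists (phi c).
by rewrite -rmorphM -rmorphB IHs.
Qed.

Lemma ideal_gen_kernel (R S : comNzRingType) (phi : {rmorphism R -> S}) s f :
  (forall g, g \in s -> phi g = 0) -> f \in ideal_gen s -> phi f = 0.
Proof.
move=> phis fs; apply/eqP; move: fs.
apply: (@ideal_gen_closed _ [pred f | phi f == 0]); rewrite ?inE ?rmorph0 //.
  move=> a g h; rewrite !inE => /eqP phig /eqP phih.
  by rewrite rmorphD rmorphM phig phih mulr0 addr0.
by move=> g /phis; rewrite inE => ->.
Qed.

Lemma prime_ideal_kernel (R : comNzRingType) (S : idomainType)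
    (phi : {rmorphism R -> S}) (I : {pred R}) :
  (forall f, (f \in I) = (phi f == 0)) -> prime_ideal I.
Proof.
move=> IE; split.
  split; rewrite ?IE ?rmorph0 ?rmorph1 ?oner_eq0 // => a u v.
  by rewrite !IE rmorphD rmorphM => /eqP-> /eqP->; rewrite mulr0 addr0.
by move=> u v; rewrite !IE rmorphM mulf_eq0.
Qed.

(** * Evaluation of generic polynomials *)

Section Generic.
Variables (K : fieldType) (n : nat).
Local Notation R := (gen_ring K n).
Local Notation X := (gen_skew K n).
Local Notation y j := (gen_col K n j 0).

Lemma gen_ring_ind (P : R -> Prop) :
    (forall c : K, P c%:MP_[_]) -> (forall v, P (indet K v)) ->
    (forall f g, P f -> P g -> P (f + g)) ->
    (forall f g, P f -> P g -> P (f * g)) ->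
  forall f, P f.
Proof.
move=> PC PX PD PM; apply: mpolyind => [|c m p _ _ Pp].
  by rewrite -mpolyC0; apply: PC.
apply: PD => //; rewrite -mul_mpolyC; apply: (PM) => //.
have P1 : P 1 by rewrite -mpolyC1; apply: PC.
rewrite mpolyXE_id; elim/big_ind: _ => // i _.
have PXi : P 'X_i by have := PX (enum_val i); rewrite /indet enum_valK.
by elim: (m i) => [|k IHk]; rewrite ?expr0 // exprS; apply: PM.
Qed.

Section Substitution.
Variables (A : comNzRingType) (c : {rmorphism K -> A}).
Variables (w : 'I_n -> 'I_n -> A) (u : 'I_n -> A).

(** The values [w i j] are read only for [i < j], so [w] need not be
    skew-symmetric: the entries of the generic matrix below the diagonal get
    their values through the sign in its definition. *)
Definition gen_eval : {rmorphism R -> A} :=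
  mmap c (fun k => match enum_val k : gen_var n with
                   | inl p => w (val p).1 (val p).2 | inr j => u j end).

Lemma gen_evalC a : gen_eval a%:MP_[_] = c a.
Proof. exact: mmapC. Qed.

Lemma gen_eval_indet v :
  gen_eval (indet K v) =
    match v with inl p => w (val p).1 (val p).2 | inr j => u j end.
Proof. by rewrite /gen_eval /indet /= mmapX mmap1U enum_rankK. Qed.

Lemma gen_eval_col j : gen_eval (y j) = u j.
Proof. by rewrite mxE gen_eval_indet. Qed.

Lemma gen_eval_xvar i j :
  gen_eval (xvar K i j) = if (i < j)%N then w i j else 0.
Proof.
rewrite /xvar; case: insubP => /= [p -> pE|/negPf->]; last exact: rmorph0.
by rewrite gen_eval_indet /= pE.
Qed.

End Substitution.

Lemma xvar_eq0 (i j : 'I_n) : (j <= i)%N -> xvar K i j = 0 :> R.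
Proof. by rewrite /xvar; case: insubP => //= p; rewrite ltnNge => /negPf->. Qed.

Lemma gen_skewE i j : X i j = xvar K i j - xvar K j i.
Proof. by rewrite mxE. Qed.

Lemma gen_col_neq0 j : y j != 0.
Proof.
apply/eqP => yj0; have := gen_eval_col idfun (fun _ _ => 0) (fun=> 1) j.
by rewrite yj0 rmorph0 => /esym/eqP; rewrite oner_eq0.
Qed.

(** * Truncated entries of the product *)

(** Cutting the product [XY] after its first [m] columns keeps the generic
    situation of every size [m <= n] inside one ring, so that the induction on
    the size never changes the ring. *)
Definition trunc_entry m (i : 'I_n) : R := \sum_(j < n | (j < m)%N) X i j * y j.
Definition trunc_seq m t : seq R :=
  take t [seq trunc_entry m i | i <- enum 'I_n].

Lemma trunc_entry_full i : trunc_entry n i = (X *m gen_col K n) i 0.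
Proof. by rewrite mxE; apply: eq_bigl => j; rewrite ltn_ord. Qed.

Lemma trunc_seq_full t : trunc_seq n t = gseq K n t.
Proof. by congr take; apply: eq_map => i; rewrite trunc_entry_full. Qed.

Lemma trunc_entryS (l i : 'I_n) :
  trunc_entry l.+1 i = trunc_entry l i + X i l * y l.
Proof.
rewrite /trunc_entry (bigD1 l) //= addrC; congr (_ + _); apply: eq_bigl => j.
by rewrite ltnS [RHS]ltn_neqAle andbC.
Qed.

Lemma mem_trunc_seq m t f :
  reflect (exists2 i : 'I_n, (i < t)%N & f = trunc_entry m i)
          (f \in trunc_seq m t).
Proof.
rewrite /trunc_seq -map_take; apply: (iffP mapP) => [[i it ->]|[i it ->]];
  exists i => //.
  case/(nthP i): it => k; rewrite size_take_min size_enum_ord leq_min.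
  by case/andP=> lt_kt lt_kn <-; rewrite nth_take // nth_enum_ord.
apply/(nthP i); exists (i : nat).
  by rewrite size_take_min size_enum_ord leq_min it /=.
by rewrite nth_take // nth_ord_enum.
Qed.

Lemma size_trunc_seq m t : (t <= n)%N -> size (trunc_seq m t) = t.
Proof. by move=> ltn; rewrite size_takel // size_map size_enum_ord. Qed.

Lemma nth_trunc_seq m t (i : 'I_n) :
  (i < t)%N -> (trunc_seq m t)`_i = trunc_entry m i.
Proof.
move=> lt_it; rewrite nth_take // (nth_map i) ?size_enum_ord //.
by rewrite nth_ord_enum.
Qed.

Lemma take_trunc_seq m t i : (i <= t)%N -> take i (trunc_seq m t) = trunc_seq m i.
Proof. exact: take_takel. Qed.

(** The entry of row [m] is excluded by [i.+1 < m]: the quadratic form of an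
    alternating matrix vanishes, so [y_m] times that entry is in the ideal of
    the earlier ones. *)
Definition trunc_regular m := forall i : 'I_n, (i.+1 < m)%N -> forall f : R,
  trunc_entry m i * f \in ideal_gen (trunc_seq m i) ->
  f \in ideal_gen (trunc_seq m i).

(** * From size [l] to size [l+1] *)

Section Step.
Variables (l : 'I_n) (t : nat).
Hypothesis lt_tl : (t < l)%N.

(** The substitution [y_l := 0], which lowers the size by one. *)
Let drop_last : {rmorphism R -> R} :=
  gen_eval (@mpolyC #|gen_var n| K) (fun i j => xvar K i j)
    (fun j => if j == l then 0 else y j).

Let drop_last_skew i j : drop_last (X i j) = X i j.
Proof.
rewrite gen_skewE rmorphB !gen_eval_xvar.
by congr (_ - _); case: ltnP => // /xvar_eq0->.
Qed.

Let drop_last_entry i : drop_last (trunc_entry l.+1 i) = trunc_entry l i.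
Proof.
rewrite trunc_entryS rmorphD rmorphM gen_eval_col eqxx mulr0 addr0 rmorph_sum.
apply: eq_bigr => j lt_jl; rewrite rmorphM drop_last_skew gen_eval_col.
by case: eqP lt_jl => // ->; rewrite ltnn.
Qed.

Let drop_last_congr f : exists c, f - drop_last f = c * y l.
Proof.
elim/gen_ring_ind: f => [a|v|f g [c fE] [d gE]|f g [c fE] [d gE]].
- by exists 0; rewrite gen_evalC subrr mul0r.
- case: v => [[[i j] /= lt_ij]|j]; rewrite gen_eval_indet /=.
    exists 0; rewrite /xvar insubT /= mul0r; apply/eqP; rewrite subr_eq0.
    by apply/eqP; congr (indet _ (inl _)); apply: val_inj.
  case: eqP => [->|_]; first by exists 1; rewrite mxE mul1r subr0.
  by exists 0; rewrite mxE subrr mul0r.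
- by exists (c + d); rewrite rmorphD mulrDl -fE -gE; ring.
- exists (c * g + drop_last f * d); rewrite rmorphM.
  rewrite mulrDl mulrAC -fE -mulrA -gE; ring.
Qed.

(** Since [y_l] is itself a nonzerodivisor, it suffices that the entries of size
    [l+1] are regular modulo [y_l]. A membership modulo [y_l] is decided after
    the substitution [y_l := 0], where it is the hypothesis for size [l]. *)
Lemma last_col_nonzerodivisor : trunc_regular l -> forall f,
  y l * f \in ideal_gen (trunc_seq l.+1 t) -> f \in ideal_gen (trunc_seq l.+1 t).
Proof.
move=> lreg; have lt_tn : (t <= n)%N by apply: ltnW; apply: ltn_trans (ltn_ord l).
apply: nonzerodivisor_moved_last => [f /eqP|i].
  by rewrite mulf_eq0 (negPf (gen_col_neq0 l)) => /eqP.
rewrite size_trunc_seq // => lt_it f.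
have lt_in : (i < n)%N by apply: leq_trans lt_it lt_tn.
rewrite (take_trunc_seq _ (ltnW lt_it)).
rewrite (@nth_trunc_seq _ _ (Ordinal lt_in)) // => gfJ.
have subst_trunc h : h \in ideal_gen (map drop_last (y l :: trunc_seq l.+1 i)) ->
    h \in ideal_gen (trunc_seq l i).
  apply: ideal_gen_subset => g /=; rewrite inE gen_eval_col eqxx.
  case/predU1P=> [->|]; first exact: ideal_gen0.
  case/mapP=> g' /mem_trunc_seq[k lt_ki ->] ->; apply: ideal_gen_mem.
  by apply/mem_trunc_seq; exists k; rewrite ?drop_last_entry.
have fJ : drop_last f \in ideal_gen (trunc_seq l i).
  apply: (lreg (Ordinal lt_in)); first exact: leq_ltn_trans lt_it lt_tl.
  by rewrite -drop_last_entry -rmorphM; apply/subst_trunc/ideal_gen_map.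
(* Lift the membership back: each [g^(l)_k] is congruent to [g^(l+1)_k]
   modulo [y_l]. *)
have [c fE] := drop_last_congr f.
apply/ideal_gen_consP.
have : drop_last f \in ideal_gen (y l :: trunc_seq l.+1 i).
  apply: ideal_gen_subset fJ => _ /mem_trunc_seq[k lt_ki ->].
  apply/ideal_gen_consP; exists (- X k l).
  apply: ideal_gen_mem; apply/mem_trunc_seq; exists k => //.
  by rewrite trunc_entryS mulNr opprK.
move=> /ideal_gen_consP[d dE]; exists (c + d).
by rewrite mulrDl -fE opprD addrA subKr.
Qed.

Let F : fieldType := {fraction {mpoly K[#|gen_var n|]}}.
Let frac : {rmorphism R -> F} := @tofrac {mpoly K[#|gen_var n|]}.

(** The point with coordinates in [F] where the first [t] entries are made to
    vanish by solving them for the variables of column [l]. *)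
Let solve_last : {rmorphism R -> F} :=
  gen_eval (frac \o @mpolyC #|gen_var n| K)
    (fun i j => if (j == l) && (i < t)%N
                then - (frac (trunc_entry l i) / frac (y l))
                else frac (xvar K i j))
    (fun j => frac (y j)).

Let solve_last_col j : solve_last (y j) = frac (y j).
Proof. exact: gen_eval_col. Qed.

Let solve_last_xvar i j :
  solve_last (xvar K i j) = if (j == l) && (i < t)%N
                            then - (frac (trunc_entry l i) / frac (y l))
                            else frac (xvar K i j).
Proof.
rewrite gen_eval_xvar; case: ltnP => // le_ji.
case: andP => [[/eqP jl lt_it]|_]; last by rewrite xvar_eq0 // rmorph0.
by move: le_ji; rewrite jl leqNgt (ltn_trans lt_it).
Qed.

(** The entries of size [l] contain no variable that has been solved for: its
    column index is [l], while [j < l] and [i < t < l]. *)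
Let solve_last_trunc (i : 'I_n) :
  (i < t)%N -> solve_last (trunc_entry l i) = frac (trunc_entry l i).
Proof.
move=> lt_it; rewrite !rmorph_sum; apply: eq_bigr => j lt_jl.
rewrite !rmorphM solve_last_col !gen_skewE !rmorphB !solve_last_xvar.
have /negPf-> : j != l by apply: contraTneq lt_jl => ->; rewrite ltnn.
have /negPf-> : i != l by apply: contraTneq lt_tl => <-; rewrite -leqNgt ltnW.
by [].
Qed.

Let solve_last_entry (i : 'I_n) :
  (i < t)%N -> solve_last (trunc_entry l.+1 i) = 0.
Proof.
move=> lt_it; rewrite trunc_entryS rmorphD rmorphM gen_skewE.
rewrite [xvar K l i]xvar_eq0; last by apply: ltnW; apply: ltn_trans lt_tl.
rewrite subr0 solve_last_trunc // solve_last_xvar eqxx lt_it solve_last_col.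
rewrite mulNr divfK ?subrr // tofrac_eq0; exact: gen_col_neq0.
Qed.

(** Multiplying by [y_l] lets [x_il] be replaced by [- g^(l)_i] modulo the ideal;
    a power of [y_l] removes all the variables that were solved for. The equation
    [solve_last h = frac h] is a way to say that [h] is free of them, and it
    makes [solve_last] injective on such [h]. *)
Let clear_last f : exists N h,
  y l ^+ N * f - h \in ideal_gen (trunc_seq l.+1 t) /\ solve_last h = frac h.
Proof.
have stay h : solve_last h = frac h -> exists N h',
    y l ^+ N * h - h' \in ideal_gen (trunc_seq l.+1 t) /\ solve_last h' = frac h'.
  by exists 0%N, h; rewrite expr0 mul1r subrr ideal_gen0.
elim/gen_ring_ind: f => [a|v|f g [N [h [fh hE]]] [M [k [gk kE]]]
                            |f g [N [h [fh hE]]] [M [k [gk kE]]]].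
- by apply: stay; rewrite gen_evalC.
- case: v => [p|j]; last by apply: stay; have := solve_last_col j; rewrite mxE.
  have xE : indet K (inl p) = xvar K (val p).1 (val p).2.
    rewrite /xvar -surjective_pairing; case: insubP => [q _ /val_inj->|] //.
    by rewrite (valP p).
  case: (boolP (((val p).2 == l) && ((val p).1 < t)%N)) => [/andP[/eqP pl lt_pt]|].
    exists 1%N, (- trunc_entry l (val p).1); split; last first.
      by rewrite !rmorphN solve_last_trunc.
    apply: ideal_gen_mem; apply/mem_trunc_seq; exists (val p).1 => //.
    rewrite trunc_entryS gen_skewE [xvar K l _]xvar_eq0; last first.
      by apply: ltnW; apply: ltn_trans lt_tl.
    by rewrite expr1 opprK addrC xE pl subr0 mulrC.
  by move=> /negPf pF; apply: stay; rewrite xE solve_last_xvar pF.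
- exists (N + M)%N, (y l ^+ M * h + y l ^+ N * k); split; last first.
    by rewrite !rmorphD !rmorphM !rmorphXn solve_last_col hE kE.
  have -> : y l ^+ (N + M) * (f + g) - (y l ^+ M * h + y l ^+ N * k) =
      y l ^+ M * (y l ^+ N * f - h) + y l ^+ N * (y l ^+ M * g - k).
    by rewrite exprD; ring.
  by rewrite ideal_genD // ideal_genMl.
- exists (N + M)%N, (h * k); split; last by rewrite !rmorphM hE kE.
  have -> : y l ^+ (N + M) * (f * g) - h * k =
      y l ^+ M * g * (y l ^+ N * f - h) + h * (y l ^+ M * g - k).
    by rewrite exprD; ring.
  by rewrite ideal_genD // ideal_genMl.
Qed.

(** If [f] is killed by [solve_last], so is the [h] that [clear_last] attaches to
    it; hence [h = 0], a power of [y_l] times [f] is in the ideal, and this power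
    can be cancelled. *)
Let trunc_ideal_kernel : trunc_regular l ->
  forall f, (f \in ideal_gen (trunc_seq l.+1 t)) = (solve_last f == 0).
Proof.
move=> lreg f; have J0 h : h \in ideal_gen (trunc_seq l.+1 t) -> solve_last h = 0.
  by apply: ideal_gen_kernel => _ /mem_trunc_seq[i lt_it ->]; apply: solve_last_entry.
apply/idP/eqP => [/J0//|f0].
have [N [h [fh hE]]] := clear_last f.
have h0 : h = 0.
  apply/eqP; rewrite -(@tofrac_eq0 {mpoly K[#|gen_var n|]}); apply/eqP.
  rewrite -[LHS]hE; move/J0: fh.
  by rewrite rmorphB rmorphM f0 mulr0 sub0r => /eqP; rewrite oppr_eq0 => /eqP.
move: fh; rewrite h0 subr0; elim: N => [|N IHN]; first by rewrite expr0 mul1r.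
by rewrite exprS -mulrA => /(last_col_nonzerodivisor lreg)/IHN.
Qed.

Lemma trunc_ideal_prime :
  trunc_regular l -> prime_ideal (ideal_gen (trunc_seq l.+1 t)).
Proof. by move=> /trunc_ideal_kernel; apply: prime_ideal_kernel. Qed.

(** The point [y_l = 1], [x_il = 1] for [i = t], all other variables [0], is a
    zero of the first [t] entries but not of the next one. *)
Lemma trunc_entry_notin (i : 'I_n) :
  i = t :> nat -> trunc_entry l.+1 i \notin ideal_gen (trunc_seq l.+1 t).
Proof.
move=> it; pose ev : {rmorphism R -> K} :=
  gen_eval idfun (fun k j => ((k == i) && (j == l))%:R) (fun j => (j == l)%:R).
have evE (k : 'I_n) : (k < l)%N -> ev (trunc_entry l.+1 k) = (k == i)%:R.
  move=> lt_kl; rewrite trunc_entryS rmorphD rmorphM gen_skewE rmorphB.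
  rewrite [xvar K l k]xvar_eq0 1?ltnW // rmorph0 subr0.
  rewrite gen_eval_xvar gen_eval_col lt_kl eqxx andbT mulr1 rmorph_sum big1 ?add0r //.
  move=> j lt_jl; rewrite rmorphM gen_eval_col.
  by case: eqP lt_jl => [->|]; rewrite ?ltnn // mulr0.
apply/negP => /(@ideal_gen_kernel _ _ ev) ev0.
have lt_il : (i < l)%N by rewrite it.
have /eqP := evE i lt_il; rewrite eqxx ev0 1?eq_sym ?oner_eq0 //.
move=> _ /mem_trunc_seq[k lt_kt ->]; rewrite evE ?(ltn_trans lt_kt) //.
by case: eqP => // ki; move: lt_kt; rewrite ki it ltnn.
Qed.

End Step.

(** A nonmember of a prime ideal is a nonzerodivisor modulo it. *)
Lemma trunc_regularP m : (m <= n)%N -> trunc_regular m.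
Proof.
elim: m => [|m IHm] lt_mn i; first by [].
rewrite ltnS => lt_im f.
have mreg : trunc_regular (Ordinal lt_mn) by apply: IHm; apply: ltnW.
have [_ Jprime] := @trunc_ideal_prime (Ordinal lt_mn) i lt_im mreg.
move=> /Jprime; rewrite -implyNb => /implyP; apply.
exact: (@trunc_entry_notin (Ordinal lt_mn)).
Qed.

End Generic.

(** * Regularity and primality *)

Theorem theorem1p3 (K : fieldType) (n : nat) :
  (2%N \notin [pchar K])%R ->
  regular_seq (gseq K n (n - 1)) /\
  (forall t : nat, (1 <= t <= n - 2)%N ->
     prime_ideal (ideal_gen (gseq K n t))).
Proof.
move=> _; have reg := @trunc_regularP K n n (leqnn n).
rewrite -trunc_seq_full; split; last first.
  move=> t /andP[t_gt0 le_t].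
  have lt1n : (1 < n)%N by apply: ltnW; rewrite -subn_gt0 (leq_trans t_gt0).
  have lt_tn : (t.+1 < n)%N by rewrite -(subnK lt1n) addn2 !ltnS.
  case: n lt_tn {reg le_t lt1n} => // m lt_tm.
  rewrite -trunc_seq_full; apply: (@trunc_ideal_prime K m.+1 ord_max) => //.
  by apply: trunc_regularP => /=.
have size_g := size_trunc_seq K n (leq_subr 1 n).
split.
  (* The entries have no constant term, so they vanish at the origin. *)
  pose ev0 : {rmorphism gen_ring K n -> K} :=
    gen_eval idfun (fun _ _ => 0) (fun=> 0).
  apply/negP => /(@ideal_gen_kernel _ _ ev0) ev1.
  have /eqP := rmorph1 ev0; rewrite ev1 ?(eq_sym 0) ?oner_eq0 //.
  move=> _ /mem_trunc_seq[i _ ->]; rewrite rmorph_sum big1 // => j _.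
  by rewrite rmorphM gen_eval_col mulr0.
move=> i; rewrite size_g => lt_i f.
have lt_in : (i < n)%N by apply: leq_trans lt_i (leq_subr 1 n).
rewrite take_trunc_seq ?(ltnW lt_i) // (@nth_trunc_seq _ _ _ _ (Ordinal lt_in)) //.
by apply: reg; move: lt_i; rewrite ltn_subRL add1n.
Qed.
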